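(* Let $p\ge 3$ be a prime, $n\in\mathbb{N}=\{1,2,\dots\}$, $a\in\mathbb{C}_p$ with $a\neq 0$ and $|a|_p<1$, and let $f:\mathbb{C}_p\to\mathbb{C}_p$, $f(x)=x^{2n+1}+ax^{n+1}$. Let $c_{\pm}=\frac12\left(-a\pm\sqrt{a^2+4}\right)$, and let $x_1,\dots,x_{2n}$ be the fixed points of $f$ given by $x_i^n=c_+$ for $i=1,\dots,n$ and $x_j^n=c_-$ for $j=n+1,\dots,2n$ (so $x_1,\dots,x_n$ are the $n$ distinct $n$-th roots of $c_+$ and $x_{n+1},\dots,x_{2n}$ are the $n$ distinct $n$-th roots of $c_-$). Then the following assertions hold. (i) If $\gcd(2n+1,p)=1$, then $x_j$ is the center of a Siegel disc and $SI(x_j)=U_1(x_j)$, for $j=1,\dots,2n$. (ii) Let $n=p^l$, $l\in\mathbb{N}$. Then $SI(x_j)=U_1(c_+^{1/n})$ for $j=1,\dots,n$ and $SI(x_j)=U_1(c_-^{1/n})$ for $j=n+1,\dots,2n$. (iii) Let $\gcd(2n+1,p)=1$ and $\gcd(n,p)=1$. Then $x_i\in S_1(c_+^{1/n})$ for $i=1,\dots,n$ and $x_j\in S_1(c_-^{1/n})$ for $j=n+1,\dots,2n$. Moreover, $SI(x_i)\cap SI(x_j)=\emptyset$ for all $i,j\in\{1,\dots,2n\}$ with $i\ne j$. (iv) Let $\gcd(n,p)\neq 1$, $n=p^k m$, $\gcd(m,p)=1$, and let $c_{ij}=\xi_i\eta_j$, where $\xi_i\in\Gamma^{(m)}$, $\eta_j^{p^k}=c$,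 $i=0,\dots,m-1$, $j=0,\dots,p^k-1$ (the $\xi_i$ enumerating $\Gamma^{(m)}$ and the $\eta_j$ enumerating the $p^k$-th roots of $c$), and $c$ denotes either $c_+$ or $c_-$. Then $SI(c_{ij})=U_1(c_{ij})=SI(c_{il})$ for $j,l\in\{0,\dots,p^k-1\}$ with $l\neq j$, and $SI(c_{ij})\cap SI(c_{sl})=\emptyset$ for $s\ne i$. (v) If $\gcd(2n+1,p)\neq 1$, with $2n+1=p^k m$, $k\ge 1$, $\gcd(m,p)=1$, then $$\bigcup_{\xi\in\Gamma_m}U_1(x_i\xi)\subset A(x_i).$$
   Context: $\mathbb{C}_p$ is the field of complex $p$-adic numbers (the completion of an algebraic closure of $\mathbb{Q}_p$) with the norm $|\cdot|_p$ extending the $p$-adic norm, $|p|_p=1/p$. For $b\in\mathbb{C}_p$ and $r>0$: $U_r(b)=\{x\in\mathbb{C}_p:|x-b|_p<r\}$ and $S_r(b)=\{x\in\mathbb{C}_p:|x-b|_p=r\}$. Here $\sqrt{a^2+4}$ is a square root in $\mathbb{C}_p$ and $c_{\pm}^{1/n}$ denotes an $n$-th root of $c_\pm$ in $\mathbb{C}_p$. For $m\in\mathbb{N}$: $\Gamma^{(m)}=\{x\in\mathbb{C}_p: x^m=1\}$ and $\Gamma_m=\bigcup_{j=1}^{\infty}\Gamma^{(m^j)}$. Write $f^k$ for the $k$-fold iterate of $f$. For an attracting fixed point $x_0$ of $f$, its basin of attraction is $A(x_0)=\{x\in\mathbb{C}_p: f^k(x)\to x_0,\ k\to\infty\}$.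 For a fixed point $x_0$, a ball $U_r(x_0)$ is called a Siegel disc (with center $x_0$) if each sphere $S_\rho(x_0)$, $\rho<r$, is invariant under $f$, i.e. $x\in S_\rho(x_0)$ implies $f^k(x)\in S_\rho(x_0)$ for all $k=1,2,\dots$. The union of all Siegel discs with center $x_0$ is called the maximal Siegel disc and is denoted $SI(x_0)$.
   Formalization: In (iii), x_i ∈ S_1(c_±^{1/n}) is stated only for roots c_±^{1/n} different from x_i (otherwise the distance is 0); in (iv), η_j are the p^k-th roots of any b with b^m = c, instead of roots of c, since otherwise the c_ij are in general not fixed points for m ≥ 2. *)

(* Defs.v *)
From HB Require Import structures.
From mathcomp Require Import all_boot all_order all_algebra.
From mathcomp Require Import all_classical all_reals all_analysis.

Set Implicit Arguments.
Unset Strict Implicit.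
Unset Printing Implicit Defensive.

Import Order.TTheory GRing.Theory Num.Theory.
Import numFieldNormedType.Exports.

Local Open Scope classical_set_scope.
Local Open Scope ring_scope.

Section NormedFields.
Variable R : realType.

Definition padic_norm (p : nat) (x : rat) : R :=
  if x == 0 then 0
  else p%:R ^ ((logn p `|denq x|%N)%:Z - (logn p `|numq x|%N)%:Z).

Definition nonarch_norm (K : fieldType) (nm : K -> R) : Prop :=
  [/\ forall x, 0 <= nm x,
      forall x, nm x = 0 <-> x = 0,
      forall x y, nm (x * y) = nm x * nm y
    & forall x y, nm (x + y) <= Num.max (nm x) (nm y)].

Definition cvg_norm (K : fieldType) (nm : K -> R) (u : nat -> K) (l : K) :
  Prop := (fun k => nm (u k - l)) @ \oo --> (0 : R).

Definition cauchy_norm (K : fieldType) (nm : K -> R) (u : nat -> K) : Prop :=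
  forall e : R, 0 < e ->
    exists N, forall i j, (N <= i)%N -> (N <= j)%N -> nm (u i - u j) < e.

Definition complete_norm (K : fieldType) (nm : K -> R) : Prop :=
  forall u, cauchy_norm nm u -> exists l, cvg_norm nm u l.

Definition norm_extends (F K : fieldType) (nmF : F -> R) (nmK : K -> R)
    (h : {rmorphism F -> K}) : Prop :=
  nonarch_norm nmK /\ forall x, nmK (h x) = nmF x.

Definition is_completion (F K : fieldType) (nmF : F -> R) (nmK : K -> R)
    (h : {rmorphism F -> K}) : Prop :=
  [/\ norm_extends nmF nmK h,
      complete_norm nmK
    & forall x (e : R), 0 < e -> exists y, nmK (x - h y) < e].

Definition is_algebraic_closure (F : fieldType) (E : closedFieldType)
    (h : {rmorphism F -> E}) : Prop :=
  forall x, algebraicOver h x.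

(* No construction of C_p is available, so it is characterized, uniquely up to
   isometric isomorphism, by the tower rat -> Qp -> Qpbar -> Cp. *)
Definition is_Cp (p : nat) (Cp : fieldType) (nm : Cp -> R) : Prop :=
  exists (Qp : fieldType) (nmQp : Qp -> R) (h0 : {rmorphism rat -> Qp})
    (Qpbar : closedFieldType) (nmQpbar : Qpbar -> R)
    (h1 : {rmorphism Qp -> Qpbar}) (h2 : {rmorphism Qpbar -> Cp}),
    [/\ is_completion (padic_norm p) nmQp h0,
        is_algebraic_closure h1,
        norm_extends nmQp nmQpbar h1
      & is_completion nmQpbar nm h2].

Section Dynamics.
Variables (K : fieldType) (nm : K -> R).

Definition oball (r : R) (b : K) : set K := [set x | nm (x - b) < r].

Definition osphere (r : R) (b : K) : set K := [set x | nm (x - b) = r].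

Definition basin (f : K -> K) (x0 : K) : set K :=
  [set x | cvg_norm nm (fun k => iter k f x) x0].

Definition siegel_disc (f : K -> K) (x0 : K) (r : R) : Prop :=
  [/\ f x0 = x0, 0 < r
    & forall rho : R, rho < r -> forall x, osphere rho x0 x ->
        forall k, (1 <= k)%N -> osphere rho x0 (iter k f x)].

Definition max_siegel_disc (f : K -> K) (x0 : K) : set K :=
  \bigcup_(r in [set r | siegel_disc f x0 r]) oball r x0.

End Dynamics.
End NormedFields.

Section Maps.
Variable K : fieldType.

Definition f_na (n : nat) (a : K) (x : K) : K :=
  x ^+ (2 * n + 1) + a * x ^+ (n + 1).

(* [s] stands for a chosen square root of [a ^+ 2 + 4]. *)
Definition c_plus (a s : K) : K := 2^-1 * (- a + s).
Definition c_minus (a s : K) : K := 2^-1 * (- a - s).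

Definition nth_roots (n : nat) (c : K) : set K := [set x | x ^+ n = c].

Definition Gamma_pow (m : nat) : set K := nth_roots m 1.

Definition Gamma (m : nat) : set K :=
  \bigcup_(j in [set j | (1 <= j)%N]) Gamma_pow (m ^ j).

Definition enumerates (N : nat) (e : 'I_N -> K) (A : set K) : Prop :=
  set_bij [set: 'I_N] A e.

End Maps.

(* Main.v *)
(* A fixed point x0 satisfies x0^n (x0^n + a) = 1, hence |x0| = 1 and, for
   |u| < 1, f (x0 + u) - x0 = u (f'(x0) + u e) with |e| <= 1 and
   f'(x0) = (2n+1) x0^(2n) mod a.  So f is an isometry around x0 on U_1(x0) if
   |2n+1| = 1 and contracts towards x0 if |2n+1| < 1.  Modulo the maximal ideal
   f is x |-> x^(2n+1), which decides which residue discs flow into U_1(x0):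
   Siegel discs cannot be larger because of nontrivial (2n+1)-st roots of unity,
   and the discs around x0 xi enter U_1(x0) after finitely many steps.  Finally
   n-th roots of a unit lie in distinct residue discs if p does not divide n and
   in a common one if n is a power of p. *)

Require Import Defs.
From HB Require Import structures.
From mathcomp Require Import all_boot all_order all_algebra.
From mathcomp Require Import all_classical all_reals all_analysis.
From mathcomp Require Import ring.

Set Implicit Arguments.
Unset Strict Implicit.
Unset Printing Implicit Defensive.

Import Order.TTheory GRing.Theory Num.Theory.
Import numFieldNormedType.Exports.

Local Open Scope classical_set_scope.
Local Open Scope ring_scope.

(** * Ultrametric norms, powers and balls *)

Section UltrametricNorm.
Variables (R : realType) (K : fieldType) (nm : K -> R).
Hypothesis nmP : nonarch_norm nm.

Lemma nm_ge0 x : 0 <= nm x.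
Proof. by case: nmP => + _ _ _; apply. Qed.

Lemma nm_eq0 x : (nm x == 0) = (x == 0).
Proof. by case: nmP => _ h _ _; apply/eqP/eqP => /h. Qed.

Lemma nmM x y : nm (x * y) = nm x * nm y.
Proof. by case: nmP => _ _ + _; apply. Qed.

Lemma nmD_max x y : nm (x + y) <= Num.max (nm x) (nm y).
Proof. by case: nmP => _ _ _; apply. Qed.

Lemma nm0 : nm 0 = 0.
Proof. by apply/eqP; rewrite nm_eq0. Qed.

Lemma nm1 : nm 1 = 1.
Proof.
have n0 : nm 1 != 0 by rewrite nm_eq0 oner_eq0.
by apply: (mulfI n0); rewrite -nmM !mulr1.
Qed.

Lemma nmX x n : nm (x ^+ n) = nm x ^+ n.
Proof. by elim: n => [|n IH]; rewrite ?nm1 // !exprS nmM IH. Qed.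

Lemma nmX_le1 x n : nm x <= 1 -> nm (x ^+ n) <= 1.
Proof. by move=> x1; rewrite nmX exprn_ile1 ?nm_ge0. Qed.

Lemma nmN x : nm (- x) = nm x.
Proof.
have /eqP := nmX (-1) 2.
rewrite sqrrN expr1n nm1 eq_sym sqrp_eq1 ?nm_ge0 // => /eqP h.
by rewrite -mulN1r nmM h mul1r.
Qed.

Lemma nm_distC x y : nm (x - y) = nm (y - x).
Proof. by rewrite -nmN opprB. Qed.

Lemma nmD_le r x y : nm x <= r -> nm y <= r -> nm (x + y) <= r.
Proof. by move=> xr yr; apply: (le_trans (nmD_max x y)); rewrite ge_max xr. Qed.

Lemma nmD_lt r x y : nm x < r -> nm y < r -> nm (x + y) < r.
Proof.
by move=> xr yr; apply: (le_lt_trans (nmD_max x y)); rewrite gt_max xr.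
Qed.

Lemma nm_dist_le r x y : nm x <= r -> nm y <= r -> nm (x - y) <= r.
Proof. by move=> xr yr; rewrite nmD_le ?nmN. Qed.

Lemma nm_dist_lt r z x y : nm (x - z) < r -> nm (z - y) < r -> nm (x - y) < r.
Proof. by move=> xz zy; rewrite -(subrKA z) nmD_lt. Qed.

Lemma nmD_dominant x y : nm y < nm x -> nm (x + y) = nm x.
Proof.
move=> yx; apply/eqP; rewrite eq_le (nmD_le (lexx _) (ltW yx)) /=.
have := nmD_max (x + y) (- y); rewrite addrK nmN le_max => /orP[//|].
by rewrite leNgt yx.
Qed.

Lemma nm_mul_lt1 x y : nm x < 1 -> nm y <= 1 -> nm (x * y) < 1.
Proof.
by move=> x1 y1; rewrite nmM; apply: le_lt_trans x1; rewrite ler_piMr ?nm_ge0.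
Qed.

Lemma nm_mul_le1 x y : nm x <= 1 -> nm y <= 1 -> nm (x * y) <= 1.
Proof. by move=> x1 y1; rewrite nmM mulr_ile1 ?nm_ge0. Qed.

Lemma nm_sum_lt1 I (r : seq I) (P : pred I) (F : I -> K) :
  (forall i, P i -> nm (F i) < 1) -> nm (\sum_(i <- r | P i) F i) < 1.
Proof.
by move=> h; elim/big_ind: _ => //; [rewrite nm0|move=> *; rewrite nmD_lt].
Qed.

Lemma nm_nat_le1 n : nm n%:R <= 1.
Proof.
by elim: n => [|n IH]; rewrite ?nm0 // -addn1 natrD nmD_le ?nm1.
Qed.

(** Serves in two directions: powers respect residue discs, and points with distant powers are
    themselves distant. *)
Lemma nm_expB_le x y n :
  nm x <= 1 -> nm y <= 1 -> nm (x ^+ n - y ^+ n) <= nm (x - y).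
Proof.
move=> x1 y1; elim: n => [|n IH]; first by rewrite subrr nm0 nm_ge0.
have -> : x ^+ n.+1 - y ^+ n.+1 = x * (x ^+ n - y ^+ n) + y ^+ n * (x - y).
  by rewrite !exprS; ring.
apply: nmD_le; rewrite nmM.
  by apply: le_trans IH; rewrite ler_piMl ?nm_ge0.
by rewrite ler_piMl ?nm_ge0 ?nmX_le1.
Qed.

Lemma exprD_taylor x u n : nm x <= 1 -> nm u <= 1 ->
  exists2 e, nm e <= 1 &
    (x + u) ^+ n = x ^+ n + n%:R * x ^+ n.-1 * u + u ^+ 2 * e.
Proof.
move=> x1 u1; elim: n => [|n [e e1 IH]].
  by exists 0; [rewrite nm0|rewrite !expr0; ring].
(* Multiplying the expansion by [x + u], the linear term contributes the first summand to the
   coefficient of [u ^+ 2] and the old remainder the second. *)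
exists (n%:R * x ^+ n.-1 + (x + u) * e).
  by apply: nmD_le; apply: nm_mul_le1; rewrite ?nm_nat_le1 ?nmX_le1 ?nmD_le.
(* [n.-1] truncates at [n = 0], where its coefficient vanishes. *)
rewrite exprS IH; case: n {IH} => [|n] /=.
  by rewrite !expr0 !expr1 mulr0n mulr1n; ring.
by rewrite !exprS -(natr1 n.+1); ring.
Qed.

Lemma oball_eq r x y : nm (x - y) < r -> oball nm r x = oball nm r y.
Proof.
move=> xy; apply/seteqP; split=> z /= h; apply: nm_dist_lt h _ => //.
by rewrite nm_distC.
Qed.

Lemma oballI0 r x y : r <= nm (x - y) -> oball nm r x `&` oball nm r y = set0.
Proof.
move=> rxy; apply/seteqP; split=> z //= [zx zy].
suff: nm (x - y) < r by rewrite ltNge rxy.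
by apply: nm_dist_lt zy; rewrite nm_distC.
Qed.

(** * Roots of units and their residue discs *)

Lemma nm_root_eq1 n x : (0 < n)%N -> nm (x ^+ n) = 1 -> nm x = 1.
Proof. by move=> n0 /eqP; rewrite nmX pexpr_eq1 ?nm_ge0 // => /eqP. Qed.

(* [n] is a unit, so [X ^+ n - w ^+ n] is separable over the residue field. *)
Lemma root_dist_eq1 n x w : (0 < n)%N -> nm n%:R = 1 ->
  nm w = 1 -> x ^+ n = w ^+ n -> x != w -> nm (x - w) = 1.
Proof.
move=> n0 nu w1 xw; apply: contra_neq_eq => xw1.
have x1 : nm x = 1 by apply: (nm_root_eq1 n0); rewrite xw nmX w1 expr1n.
have {xw1} u1 : nm (x - w) < 1.
  by rewrite lt_neqAle xw1 nm_dist_le ?x1 ?w1.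
have w1' : nm w <= 1 by rewrite w1.
(* Expanding at [w] factors [x ^+ n - w ^+ n] as [x - w] times a term congruent to
   [n%:R * w ^+ n.-1], hence of norm 1. *)
have [e e1] := exprD_taylor n w1' (ltW u1).
rewrite subrKC xw -addrA => /eqP; rewrite eq_sym addrC -subr_eq0 addrK.
have -> : n%:R * w ^+ n.-1 * (x - w) + (x - w) ^+ 2 * e =
  (x - w) * (n%:R * w ^+ n.-1 + (x - w) * e) by ring.
rewrite mulf_eq0 subr_eq0 => /orP[/eqP//|].
rewrite -nm_eq0 nmD_dominant; last first.
  by rewrite [ltRHS]nmM nmX nu w1 expr1n mulr1 nm_mul_lt1.
by rewrite nmM nmX nu w1 expr1n mulr1 oner_eq0.
Qed.

(* Frobenius is injective on the residue field. *)
Lemma frobenius_dist_lt1 p k x y : prime p -> nm p%:R < 1 ->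
  nm x <= 1 -> nm y <= 1 -> nm (x ^+ (p ^ k) - y ^+ (p ^ k)) < 1 ->
  nm (x - y) < 1.
Proof.
move=> p_pr p1; elim: k x y => [x y|k IH x y x1 y1]; first by rewrite !expr1.
rewrite expnS !exprM => /IH; rewrite !nmX_le1 // => /(_ isT isT) xyp.
suff: nm ((x - y) ^+ p) < 1.
  by rewrite nmX expr_lt1 ?nm_ge0 ?prime_gt0.
(* The middle binomial coefficients are divisible by [p]; expanding [x = (x - y) + y] avoids signs
   depending on the parity of [p]. *)
have uy : nm ((x - y) ^+ p - (x ^+ p - y ^+ p)) < 1.
  have -> : x ^+ p = (x - y + y) ^+ p by rewrite subrK.
  rewrite [in X in _ - (X - _)]exprDn; case: p {xyp IH} p_pr p1 => // p p_pr p1.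
  rewrite big_ord_recl big_ord_recr /= subn0 expr0 mulr1 bin0 mulr1n subnn.
  rewrite expr0 mul1r binn mulr1n addrA addrK opprD addrA subrr sub0r nmN.
  apply: nm_sum_lt1 => i _.
  have /dvdnP[q ->] : (p.+1 %| 'C(p.+1, bump 0 i))%N.
    by rewrite prime_dvd_bin // /bump /= add1n ltnS ltn_ord.
  rewrite mulnC mulrnA -[_ *+ p.+1]mulr_natl -mulrnAr nm_mul_lt1 //.
  by rewrite -mulr_natl !nm_mul_le1 ?nm_nat_le1 ?nmX_le1 ?nm_dist_le.
by rewrite -(subrK (x ^+ p - y ^+ p) (_ ^+ p)) nmD_lt.
Qed.

(** * Local dynamics at a fixed point *)

Section FixedPoints.
Variables (n : nat) (a x0 : K).
Hypotheses (n_gt0 : (0 < n)%N) (a_lt1 : nm a < 1).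
(** The equation [f x0 = x0] divided by [x0]: it describes the nonzero fixed points. *)
Hypothesis x0_fix : x0 ^+ n * (x0 ^+ n + a) = 1.

Let f := f_na n a.

(** If [x0 ^+ n] had norm below 1, so would the left side of [x0_fix]; if above 1, it would dominate
    [a] and the left side would have the squared norm. *)
Lemma nm_fix_eq1 : nm x0 = 1.
Proof.
apply: (nm_root_eq1 n_gt0).
have [lt1|gt1|//] := ltgtP (nm (x0 ^+ n)) 1.
  have : nm (x0 ^+ n * (x0 ^+ n + a)) < 1.
    by rewrite nm_mul_lt1 // nmD_le ?(ltW lt1) ?ltW.
  by rewrite x0_fix nm1 ltxx.
have := congr1 nm x0_fix; rewrite nmM nmD_dominant; last exact: lt_trans gt1.
by rewrite nm1 => /eqP; rewrite -expr2 sqrp_eq1 ?nm_ge0 // => /eqP.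
Qed.

Lemma f_na_fix : f x0 = x0.
Proof.
rewrite /f /f_na -[RHS]mulr1 -x0_fix mul2n -addnn !exprD expr1; ring.
Qed.

Lemma f_na_taylor u : nm u <= 1 -> exists2 e, nm e <= 1 &
  f (x0 + u) - x0 =
  u * ((2 * n + 1)%:R * x0 ^+ (2 * n) + a * ((n + 1)%:R * x0 ^+ n) + u * e).
Proof.
move=> u1; have x1 : nm x0 <= 1 by rewrite nm_fix_eq1.
have [e e1 he] := exprD_taylor (2 * n + 1) x1 u1.
have [d d1 hd] := exprD_taylor (n + 1) x1 u1.
exists (e + a * d); first by rewrite nmD_le // nm_mul_le1 // ltW.
rewrite -{2}f_na_fix /f /f_na he hd !addn1 /=; ring.
Qed.

Lemma f_na_isometry x : nm (2 * n + 1)%:R = 1 -> nm (x - x0) < 1 ->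
  nm (f x - x0) = nm (x - x0).
Proof.
move=> n1 xx0; rewrite -{1}(subrKC x0 x).
have [e e1 ->] := f_na_taylor (ltW xx0).
rewrite nmM -addrA [nm (_ * _ + _)]nmD_dominant ?nmM ?nmX nm_fix_eq1 expr1n n1 ?mulr1 //.
by rewrite nmD_lt ?nm_mul_lt1 // nm_mul_le1 ?nm_nat_le1 ?nmX_le1 ?nm_fix_eq1.
Qed.

(** A single [q] bounds all three terms of the Taylor factor, so the same rate serves along the
    whole orbit. *)
Lemma f_na_contraction q x : nm a <= q -> nm (2 * n + 1)%:R <= q ->
  nm (x - x0) <= q -> q < 1 -> nm (f x - x0) <= q * nm (x - x0).
Proof.
move=> aq nq xq q1; rewrite -{1}(subrKC x0 x).
have q0 : 0 <= q by apply: le_trans aq; exact: nm_ge0.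
have [e e1 ->] := f_na_taylor (le_trans xq (ltW q1)).
have nmMq y z : nm y <= q -> nm z <= 1 -> nm (y * z) <= q.
  by move=> yq z1; rewrite nmM; apply: le_trans yq; rewrite ler_piMr ?nm_ge0.
rewrite nmM mulrC ler_wpM2r ?nm_ge0 //.
rewrite !nmD_le ?nmMq ?nmX_le1 ?nm_mul_le1 ?nm_nat_le1 ?nmX_le1 //;
  by rewrite nm_fix_eq1.
Qed.

Lemma siegel_disc1 : nm (2 * n + 1)%:R = 1 -> siegel_disc nm f x0 1.
Proof.
move=> n1; split=> [||rho rho1 x /= xrho k _]; rewrite ?f_na_fix //.
elim: k => [//|k IH] /=.
by rewrite /osphere /= f_na_isometry // IH.
Qed.

(* A nontrivial [2n+1]-st root of unity [z] has [nm (z - 1) = 1], so [x0 * z]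
   lies on the unit sphere around [x0], but [f] maps it into the open ball. *)
Lemma siegel_disc_le1 (z : K) r : nm (2 * n + 1)%:R = 1 ->
  z ^+ (2 * n + 1) = 1 -> z != 1 -> siegel_disc nm f x0 r -> r <= 1.
Proof.
move=> n1 z1 zn1 [_ _ inv]; rewrite leNgt; apply/negP => r1.
have odd_gt0 : (0 < 2 * n + 1)%N by rewrite addn1.
have zz : nm z = 1 by apply: (nm_root_eq1 odd_gt0); rewrite z1 nm1.
have dz : nm (z - 1) = 1.
  by apply: (root_dist_eq1 odd_gt0 n1 nm1) zn1; rewrite z1 expr1n.
have : nm (f (x0 * z) - x0) = 1.
  apply: (inv 1 r1 (x0 * z) _ 1%N) => //=.
  by rewrite /osphere /= -{2}[x0]mulr1 -mulrBr nmM dz nm_fix_eq1 mulr1.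
(* The powers of degree [2 * n + 1] agree at [x0 * z] and [x0], so only a multiple of [a]
   survives. *)
have -> : f (x0 * z) - x0 = a * ((x0 * z) ^+ (n + 1) - x0 ^+ (n + 1)).
  by rewrite -{2}f_na_fix /f /f_na [_ ^+ (2 * n + 1)]exprMn z1; ring.
move=> h; suff: (1 : R) < 1 by rewrite ltxx.
by rewrite -{1}h nm_mul_lt1 // nm_dist_le ?nmX_le1 // ?nmM nm_fix_eq1 ?zz ?mul1r.
Qed.

Lemma max_siegel_disc_eq (z : K) : nm (2 * n + 1)%:R = 1 ->
  z ^+ (2 * n + 1) = 1 -> z != 1 -> max_siegel_disc nm f x0 = oball nm 1 x0.
Proof.
move=> n1 z1 zn1; apply/seteqP; split=> x /=.
  case=> r /= /(siegel_disc_le1 n1 z1 zn1) r1 xr.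
  exact: lt_le_trans xr r1.
by move=> x1; exists 1 => //=; exact: siegel_disc1.
Qed.

Lemma oball_sub_basin x : nm (2 * n + 1)%:R < 1 -> nm (x - x0) < 1 ->
  basin nm f x0 x.
Proof.
move=> n1 x1; pose q := Num.max (nm a) (Num.max (nm (2 * n + 1)%:R) (nm (x - x0))).
have q1 : q < 1 by rewrite !gt_max a_lt1 n1 x1.
have aq : nm a <= q by rewrite le_max lexx.
have nq : nm (2 * n + 1)%:R <= q by rewrite !le_max lexx orbT.
have xq : nm (x - x0) <= q by rewrite !le_max lexx !orbT.
have q0 : 0 <= q by apply: le_trans aq; exact: nm_ge0.
(* The exponent starts at 1 because [q] also bounds the initial distance; hence every iterate stays
   within [q] of [x0], as the contraction requires. *)
have bound k : nm (iter k f x - x0) <= q ^+ k.+1.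
  elim: k => [//|k IH] /=; rewrite exprS.
  apply: (le_trans (f_na_contraction aq nq _ q1)); last exact: ler_wpM2l.
  by apply: le_trans IH _; rewrite exprS ler_piMr // exprn_ile1 // ltW.
apply: (@squeeze_cvgr _ _ _ _ (fun=> 0) (fun k => q ^+ k)).
- near=> k; rewrite nm_ge0 /=; apply: le_trans (bound k) _.
  by rewrite exprS ler_piMl ?exprn_ge0 // ltW.
- exact: cvg_cst.
- by apply: cvg_expr; rewrite ger0_norm.
Unshelve. all: by end_near. Qed.

Lemma iter_f_na_reduction x k : nm x <= 1 ->
  nm (iter k f x) <= 1 /\ nm (iter k f x - x ^+ ((2 * n + 1) ^ k)) < 1.
Proof.
move=> x1; elim: k => [|k [i1 IH]] /=; first by rewrite expr1 subrr nm0.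
have fx1 : nm (a * iter k f x ^+ (n + 1)) < 1 by rewrite nm_mul_lt1 ?nmX_le1.
split; first by rewrite /f /f_na nmD_le ?nmX_le1 // ltW.
rewrite expnSr exprM {1}/f /f_na addrAC nmD_lt //.
by apply: le_lt_trans IH; rewrite nm_expB_le ?nmX_le1.
Qed.

(** If [xi ^+ (m ^ j) = 1], then raising to the power [(2 * n + 1) ^ j], a multiple of [m ^ j],
    kills [xi]; so [j] steps lead into the disc where [f] contracts. *)
Lemma oball_root1_sub_basin m xi x : nm (2 * n + 1)%:R < 1 ->
  (m %| 2 * n + 1)%N -> Gamma m xi -> nm (x - x0 * xi) < 1 -> basin nm f x0 x.
Proof.
move=> n1 m_dvd [j _ /= xij] xxi.
have m_gt0 : (0 < m ^ j)%N by rewrite expn_gt0 (dvdn_gt0 _ m_dvd) // addn1.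
have xi1 : nm xi = 1 by apply: (nm_root_eq1 m_gt0); rewrite xij nm1.
have x01 : nm (x0 * xi) <= 1 by rewrite nmM nm_fix_eq1 xi1 mulr1.
have x1 : nm x <= 1 by rewrite -(subrK (x0 * xi) x) nmD_le // ltW.
have fix_iter : iter j f x0 = x0 by elim: j {xij m_gt0} => //= j ->; exact: f_na_fix.
have fjx : nm (iter j f x - x0) < 1.
  (* With [N = (2 * n + 1) ^ j], the chain of congruences is [iter j f x], [x ^+ N],
     [(x0 * xi) ^+ N = x0 ^+ N], [iter j f x0 = x0]. *)
  apply: nm_dist_lt (iter_f_na_reduction j x1).2 _.
  apply: (nm_dist_lt (z := (x0 * xi) ^+ ((2 * n + 1) ^ j))).
    by apply: le_lt_trans xxi; rewrite nm_expB_le.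
  rewrite exprMn -(divnK (dvdn_exp2r j m_dvd)) mulnC [xi ^+ _]exprM xij expr1n.
  rewrite mulr1 mulnC (divnK (dvdn_exp2r j m_dvd)) nm_distC -{1}fix_iter.
  by apply: (iter_f_na_reduction j _).2; rewrite nm_fix_eq1.
have := oball_sub_basin n1 fjx.
(* The orbit of [iter j f x] is a tail of the orbit of [x]. *)
move=> h; have := cvg_shiftn j (fun k => nm (iter k f x - x0) : R) (nbhs (0 : R)).
rewrite propeqE => -[+ _]; apply.
by under eq_fun do rewrite iterD.
Qed.

End FixedPoints.

End UltrametricNorm.

(** * Norms of integers and roots of unity in [Cp] *)

Lemma natr_coprime_norm1 (R : realType) p n : prime p -> coprime n p ->
  padic_norm R p n%:R = 1.
Proof.
move=> p_pr np; rewrite /padic_norm pnatr_eq0 -[n%:R]/(n%:Z%:~R) denq_int numq_int.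
have n0 : (n == 0)%N = false.
  by apply: contraTF np => /eqP ->; rewrite /coprime gcd0n; case: p p_pr => [|[]].
by rewrite n0 !absz_nat logn1 logn_coprime // coprime_sym.
Qed.

Lemma natr_dvd_norm_lt1 (R : realType) p n : prime p -> (p %| n)%N ->
  padic_norm R p n%:R < 1.
Proof.
move=> p_pr pn; rewrite /padic_norm pnatr_eq0; case: eqP => [//|/eqP n0].
rewrite -[n%:R]/(n%:Z%:~R) denq_int numq_int !absz_nat logn1 sub0r -exprnN.
rewrite invf_lt1 ?exprn_gt0 ?ltr0n ?prime_gt0 //.
by rewrite expr_gt1 ?ler0n ?ltr1n ?prime_gt1 // logn_gt0 mem_primes p_pr lt0n n0.
Qed.

Section Cp.
Variables (R : realType) (p : nat) (Cp : fieldType) (nm : Cp -> R).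
Hypotheses (p_prime : prime p) (CpP : is_Cp p nm).

Lemma Cp_nonarch : nonarch_norm nm.
Proof.
by case: CpP => [Qp [nmQ [h0 [Qb [nmQb [h1 [h2 [_ _ _ [[]]]]]]]]]].
Qed.

Lemma Cp_norm_nat n : nm n%:R = padic_norm R p n%:R.
Proof.
case: CpP => [Qp [nmQ [h0 [Qb [nmQb [h1 [h2]]]]]]].
case=> [[[_ e0] _ _] _ [_ e1] [[_ e2] _ _]].
by rewrite -e0 -e1 -e2 !rmorph_nat.
Qed.

Lemma Cp_norm_coprime n : coprime n p -> nm n%:R = 1.
Proof. by move=> np; rewrite Cp_norm_nat natr_coprime_norm1. Qed.

Lemma Cp_norm_dvd n : (p %| n)%N -> nm n%:R < 1.
Proof. by move=> pn; rewrite Cp_norm_nat natr_dvd_norm_lt1. Qed.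

Lemma Cp_nat_neq0 n : (0 < n)%N -> n%:R != 0 :> Cp.
Proof.
move=> n0; case: CpP => [Qp [nmQ [h0 [Qb [nmQb [h1 [h2 _]]]]]]].
by rewrite -(rmorph_nat h2) -(rmorph_nat h1) -(rmorph_nat h0) !fmorph_eq0
  pnatr_eq0 -lt0n.
Qed.

(** A zero of [1 + X + ... + X^(n-1)] is found in the algebraically closed [Qb] and carried into the
    completion; it differs from 1, where this polynomial takes the nonzero value [n]. *)
Lemma Cp_root1 n : (1 < n)%N -> exists2 z : Cp, z ^+ n = 1 & z != 1.
Proof.
case: n => [//|n] n1; have n_gt0 : (0 < n)%N by [].
have n_neq0 := Cp_nat_neq0 (ltn0Sn n).
case: CpP => [_ [_ [_ [Qb [_ [_ [h2 _]]]]]]].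
(* [n] is now one less than in the statement; the constant coefficients [-1] encode
   [z ^+ n = - (1 + z + ... + z^(n-1))]. *)
have [z hz] := solve_monicpoly (fun=> -1 : Qb) n_gt0.
have sz : \sum_(i < n.+1) z ^+ i = 0.
  rewrite big_ord_recr /= hz -big_split big1 //= => i _.
  by rewrite mulN1r subrr.
exists (h2 z).
  by rewrite -rmorphXn; apply/eqP; rewrite -subr_eq0 -(rmorph1 h2) -rmorphB
    fmorph_eq0 subrX1 sz mulr0.
apply: contra n_neq0 => /eqP hz1.
have z1 : z = 1 by apply: (fmorph_inj h2); rewrite hz1 rmorph1.
move: sz; rewrite z1 (eq_bigr (fun=> 1)) => [|i _]; last by rewrite expr1n.
rewrite sumr_const card_ord => /(congr1 h2).
by rewrite rmorph_nat rmorph0 => ->.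
Qed.

End Cp.

(** * The fixed points of the map and the five assertions *)

Lemma enumerates_mem (K : fieldType) N (e : 'I_N -> K) A i :
  enumerates e A -> A (e i).
Proof. by case=> + _ _; apply. Qed.

Lemma enumerates_inj (K : fieldType) N (e : 'I_N -> K) A :
  enumerates e A -> injective e.
Proof. by case=> _ einj _ i j; apply: einj; rewrite inE. Qed.

(** For either sign, [c] and [c + a] are half of [s - a] and [s + a] up to a common sign, with
    product [(s ^+ 2 - a ^+ 2) / 4]. *)
Lemma c_plus_minus_fix (K : fieldType) (a s c : K) : 2 != 0 :> K ->
  s ^+ 2 = a ^+ 2 + 4 -> c = c_plus a s \/ c = c_minus a s -> c * (c + a) = 1.
Proof.
move=> two_neq0 s2 cE.
have four_neq0 : 4 != 0 :> K by rewrite (natrM _ 2 2) mulf_neq0.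
have -> : c * (c + a) = (s ^+ 2 - a ^+ 2) / 4.
  by case: cE => ->; rewrite /c_plus /c_minus; field; rewrite ?two_neq0 ?four_neq0.
by rewrite s2 addrC addKr divff.
Qed.

(* The family x is indexed by 'I_(n + n): the block lshift lists the n-th roots
   of c_plus a s, the block rshift those of c_minus a s.
   In the third conjunct, n-th roots w of c_plus (c_minus) equal to x_i itself
   have to be excluded, since nm (x_i - x_i) = 0.
   In the fourth conjunct the eta_j are the (p ^ k)-th roots of an m-th root b
   of c: with b = c one would get (xi_i * eta_j) ^+ n = c ^+ m, so that the
   xi_i * eta_j would in general not be fixed points.  The choice b = c is
   still covered whenever c ^+ m is c_plus or c_minus. *)
Theorem theorem3p12 (R : realType) (p : nat) (Cp : fieldType) (nm : Cp -> R)
    (n : nat) (a s : Cp) (x : 'I_(n + n) -> Cp)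
    (p_prime : prime p) (p_ge3 : (3 <= p)%N) (Cp_p : is_Cp p nm)
    (n_gt0 : (1 <= n)%N) (a_neq0 : a != 0) (a_lt1 : nm a < 1)
    (s_sqrt : s ^+ 2 = a ^+ 2 + 4)
    (x_plus : enumerates (fun i : 'I_n => x (lshift n i))
                         (nth_roots n (c_plus a s)))
    (x_minus : enumerates (fun i : 'I_n => x (rshift n i))
                          (nth_roots n (c_minus a s))) :
  let SI := max_siegel_disc nm (f_na n a) in
  let U := oball nm in
  let S := osphere nm in
  [/\ coprime (2 * n + 1) p ->
        forall j, (exists r, siegel_disc nm (f_na n a) (x j) r) /\
                  SI (x j) = U 1 (x j),
      forall l : nat, (1 <= l)%N -> n = (p ^ l)%N ->
        (forall w, w ^+ n = c_plus a s ->
           forall j : 'I_n, SI (x (lshift n j)) = U 1 w) /\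
        (forall w, w ^+ n = c_minus a s ->
           forall j : 'I_n, SI (x (rshift n j)) = U 1 w),
      coprime (2 * n + 1) p -> coprime n p ->
        [/\ forall w, w ^+ n = c_plus a s ->
              forall i : 'I_n, x (lshift n i) != w -> S 1 w (x (lshift n i)),
            forall w, w ^+ n = c_minus a s ->
              forall i : 'I_n, x (rshift n i) != w -> S 1 w (x (rshift n i))
          & forall i j, i != j -> SI (x i) `&` SI (x j) = set0],
      forall k m : nat, ~~ coprime n p -> n = (p ^ k * m)%N -> coprime m p ->
        forall c b : Cp, c = c_plus a s \/ c = c_minus a s -> b ^+ m = c ->
        forall (xi : 'I_m -> Cp) (eta : 'I_(p ^ k) -> Cp),
          enumerates xi (@Gamma_pow Cp m) ->
          enumerates eta (nth_roots (p ^ k) b) ->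
        (forall i j l, l != j ->
           SI (xi i * eta j) = U 1 (xi i * eta j) /\
           U 1 (xi i * eta j) = SI (xi i * eta l)) /\
        (forall i s' j l, s' != i ->
           SI (xi i * eta j) `&` SI (xi s' * eta l) = set0)
    & forall k m : nat, ~~ coprime (2 * n + 1) p ->
        (2 * n + 1 = p ^ k * m)%N -> (1 <= k)%N -> coprime m p ->
        forall i, \bigcup_(xi in @Gamma Cp m) U 1 (x i * xi)
                    `<=` basin nm (f_na n a) (x i)].
Proof.
move=> SI U S.
have nmP := Cp_nonarch Cp_p.
have p1 : nm p%:R < 1 by rewrite (Cp_norm_dvd p_prime Cp_p).
have two1 : nm 2%:R = 1.
  rewrite (Cp_norm_coprime p_prime Cp_p) // coprime_sym prime_coprime //.
  by rewrite gtnNdvd.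
have two_neq0 : 2 != 0 :> Cp by rewrite -(nm_eq0 nmP) two1 oner_eq0.
have fixw w : w ^+ n = c_plus a s \/ w ^+ n = c_minus a s ->
  w ^+ n * (w ^+ n + a) = 1 by exact: c_plus_minus_fix.
have xroot j : x j ^+ n = c_plus a s \/ x j ^+ n = c_minus a s.
  case: (split_ordP j) => i ->; [left|right].
    exact: (enumerates_mem i x_plus).
  exact: (enumerates_mem i x_minus).
have w1 w : w ^+ n = c_plus a s \/ w ^+ n = c_minus a s -> nm w = 1.
  by move=> /fixw wfix; exact: (nm_fix_eq1 nmP n_gt0 a_lt1 wfix).
have SIE w : coprime (2 * n + 1) p ->
    w ^+ n = c_plus a s \/ w ^+ n = c_minus a s -> SI w = U 1 w.
  move=> cop /fixw wfix.
  have odd_gt1 : (1 < 2 * n + 1)%N by rewrite addn1 ltnS muln_gt0.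
  have [z z1 zn1] := Cp_root1 Cp_p odd_gt1.
  apply: (max_siegel_disc_eq nmP n_gt0 a_lt1 wfix _ z1 zn1).
  exact: (Cp_norm_coprime p_prime Cp_p).
have coprime_of_dvd : (p %| n)%N -> coprime (2 * n + 1) p.
  by move=> pn; rewrite coprime_sym prime_coprime // dvdn_addr ?dvdn_mull ?dvdn1
    ?neq_ltn ?prime_gt1 ?orbT.
split.
- move=> cop j; split; last exact: SIE.
  exists 1; apply: (siegel_disc1 nmP n_gt0 a_lt1 (fixw _ (xroot j))).
  exact: (Cp_norm_coprime p_prime Cp_p).
- move=> l l_gt0 nE.
  have cop : coprime (2 * n + 1) p by rewrite coprime_of_dvd // nE dvdn_exp.
  (* As [n] is a power of [p], injectivity of Frobenius puts all roots of one value into one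
     disc. *)
  have same v w : v ^+ n = c_plus a s \/ v ^+ n = c_minus a s ->
      v ^+ n = w ^+ n -> SI v = U 1 w.
    move=> vroot vw; rewrite (SIE _ cop vroot); apply: (oball_eq nmP).
    apply: (@frobenius_dist_lt1 _ _ _ nmP p l) => //.
    + by rewrite w1.
    + by rewrite w1 // -vw.
    + by rewrite -nE vw subrr nm0.
  split=> w wE j; apply: same; [left|..|right|].
  + exact: (enumerates_mem j x_plus).
  + by rewrite wE; exact: (enumerates_mem j x_plus).
  + exact: (enumerates_mem j x_minus).
  + by rewrite wE; exact: (enumerates_mem j x_minus).
- move=> cop ncop; have n1 := Cp_norm_coprime p_prime Cp_p ncop.
  have far v w : w ^+ n = c_plus a s \/ w ^+ n = c_minus a s ->
      v ^+ n = w ^+ n -> v != w -> nm (v - w) = 1.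
    by move=> wroot; apply: (root_dist_eq1 nmP n_gt0 n1); exact: w1.
  (* For odd [p] the unit 4 dominates [a ^+ 2]. Hence [c_plus a s - c_minus a s = s] is a unit,
     which separates the two families of roots. *)
  have s1 : nm s = 1.
    apply: (@nm_root_eq1 _ _ _ nmP 2) => //; rewrite s_sqrt addrC.
    have four1 : nm (4 : Cp) = 1.
      by rewrite (natrM _ 2 2) nmM // two1 mulr1.
    by rewrite nmD_dominant // four1 nmX // expr_lt1 ?nm_ge0.
  have cpm : nm (c_plus a s - c_minus a s) = 1.
    by rewrite (_ : _ - _ = s) // /c_plus /c_minus; field.
  have cross v w : nm v = 1 -> nm w = 1 ->
      nm (v ^+ n - w ^+ n) = 1 -> 1 <= nm (v - w).
    by move=> v1 w1' <-; apply: nm_expB_le; rewrite ?v1 ?w1'.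
  have plusE i : x (lshift n i) ^+ n = c_plus a s := enumerates_mem i x_plus.
  have minusE i : x (rshift n i) ^+ n = c_minus a s := enumerates_mem i x_minus.
  split=> [w wE i xw|w wE i xw|i j ij].
  + by apply: far xw; [left|rewrite wE plusE].
  + by apply: far xw; [right|rewrite wE minusE].
  + rewrite !SIE //; apply: (oballI0 nmP).
    move: ij; case: (split_ordP i) => i' ->; case: (split_ordP j) => j' -> ij.
    * rewrite far ?plusE //; first by left.
      apply: contra ij => /eqP/(enumerates_inj x_plus) ->; exact: eqxx.
    * by apply: cross; [exact: w1|exact: w1|rewrite plusE minusE].
    * by apply: cross; [exact: w1|exact: w1|rewrite minusE plusE nm_distC].
    * rewrite far ?minusE //; first by right.
      apply: contra ij => /eqP/(enumerates_inj x_minus) ->; exact: eqxx.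
- move=> k m nnc nE mcop c b cE bE xi eta xi_enum eta_enum.
  have pn : (p %| n)%N by move: nnc; rewrite coprime_sym prime_coprime // negbK.
  have cop := coprime_of_dvd pn.
  have m_gt0 : (0 < m)%N by move: n_gt0; rewrite nE muln_gt0 => /andP[].
  have xi_root i : xi i ^+ m = 1 := enumerates_mem i xi_enum.
  have eta_root j : eta j ^+ (p ^ k) = b := enumerates_mem j eta_enum.
  have root i j :
      (xi i * eta j) ^+ n = c_plus a s \/ (xi i * eta j) ^+ n = c_minus a s.
    rewrite exprMn {1 3}nE mulnC exprM xi_root expr1n mul1r.
    by rewrite nE exprM eta_root bE.
  have xi1 i : nm (xi i) = 1 by apply: (nm_root_eq1 nmP m_gt0); rewrite xi_root nm1.
  (* The norm is read off from the fixed point [xi i * eta j], whence the index [i]. *)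
  have eta1 (i : 'I_m) j : nm (eta j) = 1.
    by have := w1 _ (root i j); rewrite nmM // xi1 mul1r.
  have eta_near (i : 'I_m) j l : nm (eta j - eta l) < 1.
    apply: (@frobenius_dist_lt1 _ _ _ nmP p k) => //; rewrite ?(eta1 i) //.
    by rewrite !eta_root subrr nm0.
  have near i j l : nm (xi i * eta j - xi i * eta l) < 1.
    by rewrite -mulrBr nmM // xi1 mul1r (eta_near i).
  split=> [i j l _|i s' j l s'i].
    by rewrite !SIE //; split=> //; exact: (oball_eq nmP).
  (* Recentring the second disc at [xi s' * eta j] leaves the distance of two distinct [m]-th roots
     of unity, which is 1 because [p] does not divide [m]. *)
  rewrite !SIE // /U (oball_eq nmP (near s' l j)); apply: (oballI0 nmP).
  rewrite -mulrBl nmM // (eta1 i) mulr1.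
  rewrite (root_dist_eq1 nmP m_gt0 (Cp_norm_coprime p_prime Cp_p mcop)) ?xi_root //.
  by apply: contra s'i => /eqP/(enumerates_inj xi_enum) ->.
- move=> k m ncop nE k_gt0 mcop i y [xi xiG yxi].
  apply: (oball_root1_sub_basin nmP n_gt0 a_lt1 (fixw _ (xroot i)) _ _ xiG yxi).
    apply: (Cp_norm_dvd p_prime Cp_p).
    by move: ncop; rewrite coprime_sym prime_coprime // negbK.
  by rewrite nE dvdn_mull.
Qed.
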